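(* Let $b\ge 2$ and let $n_1,\ldots,n_b$ be positive integers. Let $\Delta$ be the squared distance matrix of the starlike block graph $\mathcal{S}(n_1,n_2,\ldots,n_b)$ and let $\Delta_{22}$ be the principal submatrix of $\Delta$ obtained by deleting the row and column corresponding to the central cut vertex. Then $$\det \Delta = (-1)^{\sum_{i=1}^b n_i} \sum_{i=1}^b n_i \prod_{j \ne i} (3n_j+1),$$ and $$\det \Delta_{22} = (-1)^{\sum_{i=1}^{b} n_i -1} \left(4\sum_{i=1}^{b} n_i \prod_{j \ne i} (3n_j+1) - \prod_{i=1}^{b}(3n_i+1)\right).$$
   Context: The starlike block graph $\mathcal{S}(n_1,\ldots,n_b)$ is the graph consisting of $b\ge 2$ blocks which are the complete graphs $K_{n_1+1},\ldots,K_{n_b+1}$ (each $n_i\ge 1$), all sharing exactly one common vertex, the central cut vertex. It has $n=1+\sum_{i=1}^b n_i$ vertices. For a simple connected graph $G$ with vertices $v_1,\ldots,v_n$, the squared distance matrix is $\Delta(G)=[d(v_i,v_j)^2]$, where $d$ is the shortest-path distance. In $\prod_{j\neq i}$ the index $j$ runs over $\{1,\ldots,b\}\setminus\{i\}$. *)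

(* Defs.v *)
From HB Require Import structures.
From mathcomp Require Import all_boot all_order all_algebra.
Set Implicit Arguments.
Unset Strict Implicit.
Unset Printing Implicit Defensive.
Import GRing.Theory.

Section Distance.
Variables (T : finType) (e : rel T).

Definition has_walk (x y : T) (k : nat) : bool :=
  [exists p : k.-tuple T, path e x p && (last x p == y)].

(* A shortest walk visits each vertex at most once, so only lengths below #|T|
   need to be searched; the value is #|T| when x and y are not connected. *)
Definition gdist (x y : T) : nat := find (has_walk x y) (iota 0 #|T|).

Lemma has_walkP x y k :
  reflect (exists p : seq T, [/\ path e x p, last x p = y & size p = k])
          (has_walk x y k).
Proof.
apply: (iffP existsP) => [[p /andP[ep /eqP lp]]|[p [ep lp sp]]].
  by exists p; rewrite size_tuple.
have sp' : size p == k by apply/eqP.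
by exists (Tuple sp'); rewrite ep lp eqxx.
Qed.

Lemma gdist_min x y (p : seq T) :
  path e x p -> last x p = y -> gdist x y <= size p.
Proof.
move=> ep lp; rewrite leqNgt; apply/negP => lt_p.
have lt_pT : size p < #|T|.
  by rewrite (leq_trans lt_p) // -[X in _ <= X](size_iota 0) find_size.
have := before_find 0 lt_p; rewrite nth_iota // add0n => /has_walkP.
by apply; exists p.
Qed.

Lemma gdist_walk x y : connect e x y ->
  exists p : seq T, [/\ path e x p, last x p = y & size p = gdist x y].
Proof.
case/connectP => p0 /shortenP[p ep up _] lp.
have lt_pT : size p < #|T|.
  by rewrite -[(size p).+1]/(size (x :: p)) -(card_uniqP up) max_card.
have hasw : has (has_walk x y) (iota 0 #|T|).
  apply/hasP; exists (size p); first by rewrite mem_iota.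
  by apply/has_walkP; exists p.
have := nth_find 0 hasw; rewrite nth_iota ?add0n; last first.
  by rewrite -[X in _ < X](size_iota 0) -has_find.
by move/has_walkP.
Qed.

Local Open Scope ring_scope.

Definition sqdist_mx : 'M[int]_#|T| :=
  \matrix_(i, j) ((gdist (enum_val i) (enum_val j))%:R ^+ 2).

End Distance.

Definition principal_submx (R : Type) (m : nat) (k : 'I_m) (A : 'M[R]_m)
  : 'M[R]_m.-1 := row' k (col' k A).

(* None is the central cut vertex; the block K_{n_i + 1} consists of None and
   of the n i vertices Some (existT _ i a), a : 'I_(n i). *)
Definition starlike_vertex (b : nat) (n : 'I_b -> nat) : finType :=
  option {i : 'I_b & 'I_(n i)}.

Definition starlike (b : nat) (n : 'I_b -> nat) : rel (starlike_vertex n) :=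
  fun u v => match u, v with
  | None, None => false
  | None, Some _ | Some _, None => true
  | Some x, Some y => (tag x == tag y) && (x != y)
  end.

Lemma starlike_irr (b : nat) (n : 'I_b -> nat) : irreflexive (starlike (n := n)).
Proof. by case=> [x|] //=; rewrite !eqxx. Qed.

Lemma starlike_sym (b : nat) (n : 'I_b -> nat) : symmetric (starlike (n := n)).
Proof. by case=> [x|] [y|] //=; rewrite eq_sym [x == y]eq_sym. Qed.

Lemma starlike_connected (b : nat) (n : 'I_b -> nat) (u v : starlike_vertex n) :
  connect (starlike (n := n)) u v.
Proof.
apply: (@connect_trans _ _ None).
  by case: u => [x|]; [apply: connect1 | apply: connect0].
by case: v => [y|]; [apply: connect1 | apply: connect0].
Qed.

Lemma card_starlike (b : nat) (n : 'I_b -> nat) :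
  #|starlike_vertex n| = (1 + \sum_(i < b) n i)%N.
Proof.
rewrite card_option card_tagged sumnE big_map big_enum /= add1n.
by congr S; apply: eq_bigr => i _; rewrite card_ord.
Qed.

Definition starlike_center (b : nat) (n : 'I_b -> nat)
  : 'I_#|starlike_vertex n| := enum_rank (None : starlike_vertex n).

(* Main.v *)
Require Import Defs.
From mathcomp Require Import all_boot all_order all_algebra.
From mathcomp Require Import ring.
Import GRing.Theory Num.Theory.
Local Open Scope ring_scope.

(** Two vertices of a starlike block graph are at squared distance 0, 1 or 4,
    and, apart from the 0 on the diagonal, this value depends only on the classes
    of the two vertices, where the classes are the centre alone and the
    non-central part of each block.  So [Delta + 1] is a blow-up of the
    [(1 + b) x (1 + b)] matrix

      [M = ( 1  1 ; 1  4 J - 3 I )].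

    The identity [det (1 - X Y) = det (1 - Y X)] collapses the determinant of
    such a blow-up ([det_1sub_quotient]): [det (- Delta)] equals
    [det (1 - M D)], where [D] is the diagonal matrix of the class sizes.
    Deleting the centre only changes the first class size from 1 to 0, so
    both formulas come from one computation with an indeterminate first class
    size [c].  In [1 - M D], subtracting 4 times the central row from all the
    others leaves the arrowhead matrix

      [( 1 - c  - n ; 3 c - 4  diag (3 n_i + 1) )],

    whose determinant is [(1 - c) P + (3 c - 4) S] ([det_quotient]), with
    [P = prod_i (3 n_i + 1)] and [S = sum_i n_i prod_(j != i) (3 n_j + 1)].
    The values [c = 1] and [c = 0] give [- S] and [P - 4 S], and the sign
    [(-1)^m] of negating an [m x m] matrix does the rest
    ([det_sqdist_induced]). *)

(** The products of the block matrices [(1 0 ; -X 1)] and [(1 Y ; X 1)]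
    in either order are block triangular, with diagonal blocks [1, 1 - X Y]
    for one order and [1 - Y X, 1] for the other. *)
Lemma det_1mulmxC (R : comNzRingType) (m p : nat)
    (X : 'M[R]_(m, p)) (Y : 'M[R]_(p, m)) :
  \det (1%:M - X *m Y) = \det (1%:M - Y *m X).
Proof.
pose L := block_mx (1%:M : 'M[R]_p) 0 (- X) (1%:M : 'M[R]_m).
pose B := block_mx (1%:M : 'M[R]_p) Y X (1%:M : 'M[R]_m).
have LB : L *m B = block_mx 1%:M Y 0 (1%:M - X *m Y).
  rewrite /L /B mulmx_block !mul1mx !mul0mx !addr0 mulmx1 addNr.
  by rewrite mulNmx addrC.
have BL : B *m L = block_mx (1%:M - Y *m X) Y 0 1%:M.
  rewrite /L /B mulmx_block !mul1mx !mulmx0 !mulmx1 !add0r subrr.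
  by rewrite mulmxN.
have := det_mulmx L B; rewrite LB det_ublock det1 mul1r => ->.
by rewrite mulrC -det_mulmx BL det_ublock det1 mulr1.
Qed.

(** With [U] the 0/1 incidence matrix of the labelling, the blow-up is
    [U M U^T], while [U^T U] is the diagonal matrix of the class sizes; the
    two are exchanged by [det_1mulmxC].  Labels that are not reached are
    classes of size 0. *)
Lemma det_1sub_quotient (R : comNzRingType) (m p : nat) (l : 'I_m -> 'I_p)
    (M : 'M[R]_p) :
  \det (1%:M - mxsub l l M) =
  \det (1%:M - M *m diag_mx (\row_c #|[pred i | l i == c]|%:R)).
Proof.
pose U : 'M[R]_(m, p) := rowsub l 1%:M.
have UM : U *m M = rowsub l M by rewrite mul_rowsub_mx mul1mx.
have -> : mxsub l l M = U *m (M *m U^T).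
  rewrite mulmxA UM; apply/matrixP => i j; rewrite !mxE (bigD1 (l j)) //=.
  rewrite !mxE eqxx mulr1 big1 ?addr0 // => c nc.
  by rewrite !mxE eq_sym (negbTE nc) mulr0.
rewrite (det_1mulmxC _ _ _ U) -mulmxA; congr (\det (_ - _ *m _)).
apply/matrixP => c d; rewrite !mxE -sum1_card natr_sum -sumrMnl [LHS]big_mkcond.
rewrite [RHS]big_mkcond /=; apply: eq_bigr => i _; rewrite !mxE inE.
have [->|nc] := eqVneq (l i) c; last by rewrite mul0r.
by rewrite mul1r.
Qed.

(** Multiplying on the right by [(P 0 ; -v w 1)], with [P = prod_i d_i] and
    [w_i = P / d_i], clears the column [v] without any division; the factor
    [P] introduced on both sides is then cancelled. *)
Lemma det_arrowhead (R : idomainType) (b : nat) (c : R) (u v d : 'I_b -> R) :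
  (forall i, d i != 0) ->
  \det (block_mx (c%:M : 'M_1) (\row_i u i) (\col_i v i)
          (diag_mx (\row_i d i))) =
  c * \prod_i d i - \sum_i u i * v i * \prod_(j | j != i) d j.
Proof.
move=> d_neq0; set A := block_mx _ _ _ _; set P := \prod_i d i.
have P_neq0 : P != 0 by apply/prodf_neq0.
pose w i := \prod_(j | j != i) d j.
pose E := block_mx (P%:M : 'M_1) 0 (\col_i (- (v i * w i))) (1%:M : 'M_b).
have AE : A *m E = block_mx (c * P - \sum_i u i * v i * w i)%:M (\row_i u i)
                       0 (diag_mx (\row_i d i)).
  rewrite mulmx_block !mulmx0 !mulmx1 !add0r; congr block_mx.
    rewrite -scalar_mxM; apply/matrixP => i j.
    rewrite !ord1 !mxE /= !mulr1n -sumrN; congr (_ + _).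
    by apply: eq_bigr => k _; rewrite !mxE mulrN mulrA.
  apply/matrixP => i j; rewrite mul_mx_scalar mul_diag_mx !mxE.
  by rewrite /P (bigD1 i) //= -/(w i); ring.
have := det_mulmx A E.
rewrite AE det_ublock det_lblock !det_scalar1 det1 det_diag mulr1.
under eq_bigr do rewrite mxE.
by move/(mulIf P_neq0).
Qed.

(** Squared distances between distinct vertices of the given classes, the
    centre being the first class.  The first diagonal entry does not stand for
    such a pair: it is 1 so that subtracting the identity gives 0 at the centre,
    as for every other vertex. *)
Definition quotient_mx (b : nat) : 'M[int]_(1 + b) :=
  block_mx 1%:M (const_mx 1) (const_mx 1) (const_mx 4 - 3%:M).

Definition block_label {b : nat} {n : 'I_b -> nat} (v : starlike_vertex n)
  : 'I_(1 + b) :=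
  if v is Some x then rshift 1 (tag x) else lshift b ord0.

Lemma gdist_starlike (b : nat) (n : 'I_b -> nat) (u v : starlike_vertex n) :
  gdist (starlike (n := n)) u v =
  if u == v then 0%N else if starlike u v then 1%N else 2%N.
Proof.
set e := starlike (n := n).
have [p [ep lp sp]] := gdist_walk (starlike_connected u v).
have [uv|uv] := eqVneq u v.
  by apply/eqP; rewrite -leqn0; apply: (@gdist_min _ e u v [::]).
have p_gt0 : (0 < gdist e u v)%N.
  by rewrite -sp; case: (p) lp uv => //= ->; rewrite eqxx.
case: ifPn => [euv|neuv]; apply/eqP; rewrite eqn_leq.
  by rewrite p_gt0 andbT; apply: (@gdist_min _ e u v [:: v]); rewrite //= euv.
apply/andP; split.
  (* non-adjacent distinct vertices are joined through the centre *)
  case: u v uv neuv {ep lp sp p_gt0} => [x|] [y|] // _ _.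
  exact: (@gdist_min _ e (Some x) (Some y) [:: None; Some y]).
rewrite ltn_neqAle p_gt0 andbT eq_sym; apply/negP => /eqP d1.
move: sp ep lp; rewrite d1; case: p => [|w []] //= _.
by rewrite andbT => euw wv; case/negP: neuv; rewrite -wv.
Qed.

Lemma sqdist_starlike (b : nat) (n : 'I_b -> nat) (u v : starlike_vertex n) :
  (gdist (starlike (n := n)) u v)%:R ^+ 2 =
  quotient_mx b (block_label u) (block_label v) - (u == v)%:R.
Proof.
rewrite gdist_starlike /quotient_mx.
case: u v => [x|] [y|]; rewrite /= ?block_mxEul ?block_mxEur ?block_mxEdl
  ?block_mxEdr !mxE //.
rewrite (inj_eq (@Some_inj _)).
have [->|nxy] := eqVneq x y; first by rewrite eqxx.
by have [|] := eqVneq (tag x) (tag y).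
Qed.

Lemma card_block (b : nat) (n : 'I_b -> nat) (i : 'I_b) :
  #|[pred x : {i : 'I_b & 'I_(n i)} | tag x == i]| = n i.
Proof.
rewrite -sum1_card.
rewrite (eq_bigl (fun x => (tag x == i) && true)) => [|x]; last first.
  by rewrite inE andbT.
rewrite -(@sig_big_dep _ _ addn _ (fun j => 'I_(n j)) (pred1 i)
            (fun _ => xpredT) (fun _ _ => 1%N)) big_pred1_eq.
by rewrite sum1_card card_ord.
Qed.

(** [c] is the size of the class of the centre.  Keeping it as a parameter
    makes one elimination serve the graph ([c = 1]) and the graph with its
    centre deleted ([c = 0]). *)
Lemma det_quotient (b : nat) (n : 'I_b -> nat) (c : int) :
  \det (1%:M - quotient_mx b *m
                 diag_mx (row_mx c%:M (\row_i (n i)%:R : 'rV_b))) =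
  (1 - c) * \prod_i (3 * (n i)%:R + 1) +
  (3 * c - 4) * \sum_i (n i)%:R * \prod_(j | j != i) (3 * (n j)%:R + 1).
Proof.
set Q := 1%:M - _.
pose L := block_mx (1%:M : 'M[int]_1) 0 (const_mx (- 4)) (1%:M : 'M[int]_b).
have LQ : L *m Q = block_mx (1 - c)%:M (\row_i (- (n i)%:R))
    (\col_i (3 * c - 4)) (diag_mx (\row_i (3 * (n i)%:R + 1))).
  rewrite /Q /quotient_mx diag_mx_row mulmx_block (scalar_mx_block 1 b).
  rewrite opp_block_mx add_block_mx mulmx_block !mulmx0 !mul0mx !mul1mx.
  rewrite !addr0 !add0r !mul_mx_diag.
  congr block_mx; apply/matrixP => i j;
    rewrite !(mxE, big_ord1, ord1) /= ?mulr1n.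
  - by [].
  - by rewrite mul1r.
  - by ring.
  - by case: eqVneq => [->|_]; rewrite ?mulr1n ?mulr0n; ring.
transitivity (\det (L *m Q)); first by rewrite det_mulmx det_lblock !det1 !mul1r.
rewrite LQ det_arrowhead => [|i]; last by rewrite -natrM natr1 pnatr_eq0.
rewrite mulr_sumr -sumrN; congr (_ + _); apply: eq_bigr => i _; ring.
Qed.

(** The rows are indexed through an injection [h], because the rows left after
    deleting the centre carry no vertex type of their own; [h] may miss the
    centre but no other vertex, so the class sizes are [c] and the [n i]. *)
Lemma det_sqdist_induced (b : nat) (n : 'I_b -> nat) (m : nat)
    (h : 'I_m -> starlike_vertex n) (h_inj : injective h)
    (h_some : forall x, Some x \in codom h) (c := (None \in codom h : nat)) :
  \det (\matrix_(i, j) (gdist (starlike (n := n)) (h i) (h j))%:R ^+ 2) =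
  (-1) ^+ m * ((1 - c%:R) * \prod_i (3 * (n i)%:R + 1) +
  (3 * c%:R - 4) * \sum_i (n i)%:R * \prod_(j | j != i) (3 * (n j)%:R + 1))
  :> int.
Proof.
pose l i := block_label (h i).
have -> : (\matrix_(i, j) (gdist (starlike (n := n)) (h i) (h j))%:R ^+ 2) =
    -1 *: (1%:M - mxsub l l (quotient_mx b)).
  apply/matrixP => i j; rewrite mxE sqdist_starlike !mxE (inj_eq h_inj).
  by rewrite mulN1r opprB.
rewrite detZ det_1sub_quotient -det_quotient; congr (_ * \det (_ - _ *m diag_mx _)).
apply/rowP => k; rewrite !mxE.
have -> : #|[pred i | l i == k]| = #|[predI codom h & [pred v | block_label v == k]]|.
  by rewrite -(card_preim h_inj).
case: split_ordP => [j ->|j ->].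
  rewrite !ord1 mxE mulr1n /c; congr (_%:R).
  have lab0 (v : starlike_vertex n) :
      (block_label v == lshift b 0) = (v == None).
    by case: v => [x|] /=; rewrite ?eq_rlshift ?eqxx.
  have [c1|c0] := boolP (None \in codom h).
    apply: (@eq_card1 _ None) => v; rewrite !inE lab0.
    by case: eqP => [->|_]; rewrite ?c1 ?andbF.
  apply: eq_card0 => v; rewrite !inE lab0.
  by case: eqP => [->|_]; rewrite ?(negbTE c0) ?andbF.
rewrite mxE -(card_block _ n); congr (_%:R).
rewrite -[RHS](card_image (@Some_inj _)).
apply: eq_card => -[x|]; rewrite !inE.
  by rewrite h_some (mem_image (@Some_inj _)) inE /= eq_rshift.
rewrite /= eq_lrshift andbF; apply/esym/negbTE.
by apply/imageP => -[].
Qed.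

Theorem corollary2p5 (b : nat) (n : 'I_b -> nat)
    (hb : (2 <= b)%N) (hn : forall i : 'I_b, (0 < n i)%N) :
  let Delta := sqdist_mx (@starlike b n) in
  let Delta22 := principal_submx (starlike_center n) Delta in
  \det Delta =
    (-1) ^+ (\sum_(i < b) n i)%N *
    (\sum_(i < b) (n i)%:R * \prod_(j < b | j != i) (3 * (n j)%:R + 1))
  /\
  \det Delta22 =
    (-1) ^+ ((\sum_(i < b) n i) - 1)%N *
    (4 * (\sum_(i < b) (n i)%:R * \prod_(j < b | j != i) (3 * (n j)%:R + 1))
     - \prod_(i < b) (3 * (n i)%:R + 1)).
Proof.
move=> Delta Delta22.
set S : int := \sum_i _ * _; set P := \prod_i _.
have N_gt0 : (0 < \sum_i n i)%N.
  by rewrite (bigD1 (Ordinal (ltnW hb))) //= addn_gt0 hn.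
split.
  rewrite (det_sqdist_induced _ _ _ _ enum_val_inj); last first.
    by move=> x; apply/codomP; exists (enum_rank (Some x)); rewrite enum_rankK.
  have -> : None \in codom (@enum_val (starlike_vertex n) predT).
    by apply/codomP; exists (enum_rank None); rewrite enum_rankK.
  by rewrite card_starlike add1n exprS -/S -/P /=; ring.
pose h (i : 'I_#|starlike_vertex n|.-1) :=
  enum_val (lift (starlike_center n) i) : starlike_vertex n.
have h_inj : injective h by move=> i j /enum_val_inj /lift_inj.
have h_codom v : (v \in codom h) = (v != None).
  apply/codomP/idP => [[i ->]|v_neq].
    by rewrite -(inj_eq enum_rank_inj) enum_valK eq_sym neq_lift.
  have : starlike_center n != enum_rank v by rewrite (inj_eq enum_rank_inj) eq_sym.
  by case/unlift_some => i Ei _; exists i; rewrite /h -Ei enum_rankK.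
have -> : Delta22 = \matrix_(i, j) (gdist (starlike (n := n)) (h i) (h j))%:R ^+ 2.
  by apply/matrixP => i j; rewrite !mxE.
rewrite (det_sqdist_induced _ _ _ _ h_inj) => [|x]; last by rewrite h_codom.
rewrite h_codom /= card_starlike add1n /= -/S -/P.
by case: (\sum_i n i)%N N_gt0 => // N _; rewrite subn1 exprS; ring.
Qed.
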